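(* Let $K=\mathbb{C}$ or $K=\mathbb{R}$, let $m\ge 1$ be an integer, $n=2m$, and let $\mathcal{R}_n$ be the dihedral quandle of order $n$. Let $V_{triv,even}$ and $V_{triv,odd}$ be the right $K[\mathcal{R}_n]$-submodules of $K[\mathcal{R}_n]$ generated by $\sum_{i=0}^{m-1}v_{2i}$ and $\sum_{i=0}^{m-1}v_{2i+1}$ respectively. If $m=2t$ is even, let $V_{ref,even}$ and $V_{ref,odd}$ be the submodules generated by $\sum_{i=0}^{t-1}v_{4i}-\sum_{i=0}^{t-1}v_{4i+2}$ and $\sum_{i=0}^{t-1}v_{4i+1}-\sum_{i=0}^{t-1}v_{4i+3}$ respectively. Then for every integer $j$ with $1\le j<m/2$ there are submodules $V_{j,even}\subseteq K[A_n]$ and $V_{j,odd}\subseteq K[B_n]$, each isomorphic as a representation of $D_m$ to the two-dimensional representation $\psi_j$, such that the following are (internal) direct sum decompositions of $K[\mathcal{R}_n]$ into indecomposable right $K[\mathcal{R}_n]$-modules: (1) if $m$ is odd, $$K[\mathcal{R}_n]= V_{triv, even} \oplus V_{triv, odd} \oplus \bigoplus_{j=1}^{(m-1)/2} V_{j, even} \oplus \bigoplus_{j=1}^{(m-1)/2} V_{j, odd};$$ (2) if $m=2t$ is even, $$K[\mathcal{R}_n]= V_{triv, even} \oplus V_{triv, odd} \oplus V_{ref, even} \oplus V_{ref, odd} \oplus \bigoplus_{j=1}^{t-1} V_{j, even} \oplus \bigoplus_{j=1}^{t-1} V_{j, odd}.$$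
   Context: The dihedral quandle $\mathcal{R}_n$ is the set $\{0,1,\dots,n-1\}$ with the operation $i\triangleright j=2j-i \pmod n$. The quandle ring $K[\mathcal{R}_n]$ is the $K$-vector space with basis $\{v_0,\dots,v_{n-1}\}$ ($v_i$ corresponding to $i\in\mathcal{R}_n$) and bilinear (in general non-associative) multiplication $v_i\cdot v_j=v_{i\triangleright j}$. For $j\in\mathcal{R}_n$ let $R_j$ be the linear right multiplication map $v_i\mapsto v_{i\triangleright j}$. A right $K[\mathcal{R}_n]$-submodule of $K[\mathcal{R}_n]$ is a linear subspace invariant under all $R_j$, $j\in\mathcal{R}_n$ (equivalently, a subrepresentation for the group $\mathrm{Inn}(\mathcal{R}_n)$ generated by all $R_j$). The submodule generated by a vector is the smallest submodule containing it. A nonzero submodule is indecomposable if it is not the direct sum of two nonzero submodules. For $n=2m$ put $A_n=\{0,2,\dots,n-2\}$ and $B_n=\{1,3,\dots,n-1\}$ (the orbits of $\mathrm{Inn}(\mathcal{R}_n)$ on $\mathcal{R}_n$), and let $K[A_n]$, $K[B_n]$ be the spans of $\{v_i: i\in A_n\}$ and $\{v_i: i\in B_n\}$; these are submodules and $K[\mathcal{R}_n]=K[A_n]\oplus K[B_n]$. Let $D_m=\langle r,s\mid r^m=s^2=1,\ srs^{-1}=r^{-1}\rangle$ be the dihedral group of order $2m$. It acts on $K[A_n]$ and on $K[B_n]$ by letting $s$ act as $R_0$ and $r$ as $R_1R_0$ (first apply $R_0$, then $R_1$); the $D_m$-invariant subspaces are exactly the right $K[\mathcal{R}_n]$-submodules.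 Fix a primitive $m$-th root of unity $\epsilon=e^{i\theta}\in\mathbb{C}$. The two-dimensional representation $\psi_j$ of $D_m$ is, for $K=\mathbb{C}$, $$\psi_j(r)=\begin{pmatrix}\epsilon^j&0\\0&\epsilon^{-j}\end{pmatrix},\qquad \psi_j(s)=\begin{pmatrix}0&1\\1&0\end{pmatrix},$$ and for $K=\mathbb{R}$ it is its real form $$\psi_j(r)=\begin{pmatrix}\cos j\theta&-\sin j\theta\\ \sin j\theta&\cos j\theta\end{pmatrix},\qquad \psi_j(s)=\begin{pmatrix}1&0\\0&-1\end{pmatrix}.$$ *)

(* Defs.v *)
From HB Require Import structures.
From mathcomp Require Import all_boot all_order all_algebra all_fingroup.
From mathcomp Require Import complex.
From mathcomp Require Import boolp reals trigo.

Set Implicit Arguments.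
Unset Strict Implicit.
Unset Printing Implicit Defensive.

Import GRing.Theory.

Local Open Scope ring_scope.

(** * Dihedral quandles and their quandle rings *)

(* [2 * j - i] modulo [n], written with [n - i] to avoid truncated
   subtraction; [i] itself witnesses [0 < n]. *)
Definition quandle_op (n : nat) (i j : 'I_n) : 'I_n :=
  Ordinal (ltn_pmod (2 * j + (n - i)) (leq_ltn_trans (leq0n i) (ltn_ord i))).

Notation "i |> j" := (quandle_op i j) (at level 45, no associativity).

Notation quandle_ring K n := ('cV[K]_n).

Section QuandleRing.
Variables (K : fieldType) (n : nat).
Implicit Types (x y : quandle_ring K n) (U W : {vspace quandle_ring K n}).

(* The basis vector v_k, for k < n; it is indexed by [nat] so that v_(2i), ...
   can be written directly, and is 0 when n <= k. *)
Definition qbasis (k : nat) : quandle_ring K n :=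
  \col_(i < n) (val i == k)%:R.

Definition qmul x y : quandle_ring K n :=
  \sum_(i < n) \sum_(j < n) (x i 0 * y j 0) *: qbasis (i |> j).

Definition right_mul (k : nat) x : quandle_ring K n := qmul x (qbasis k).

Lemma right_mul_basis (i j : 'I_n) :
  right_mul j (qbasis i) = qbasis (i |> j).
Proof.
rewrite /right_mul /qmul (bigD1 i) //= (bigD1 j) //= !mxE !eqxx mulr1 scale1r.
rewrite !big1 ?addr0 // => [k ki|k kj]; last first.
  by rewrite !mxE (inj_eq val_inj) (negbTE kj) mulr0 scale0r.
by rewrite big1 // => l _; rewrite !mxE (inj_eq val_inj) (negbTE ki) mul0r scale0r.
Qed.

Definition is_submodule U : Prop :=
  forall (j : 'I_n) x, x \in U -> right_mul j x \in U.

Definition is_smallest_submodule x U : Prop :=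
  [/\ is_submodule U, x \in U
    & forall W, is_submodule W -> x \in W -> (U <= W)%VS].

Lemma smallest_submodule_exists x : exists U, is_smallest_submodule x U.
Proof.
pose P d := `[< exists U, [/\ is_submodule U, x \in U & \dim U = d] >].
have exP : exists d, P d.
  by exists (\dim (fullv : {vspace quandle_ring K n})); apply/asboolP;
    exists fullv; split; rewrite ?memvf // => j y _; rewrite memvf.
case: (ex_minnP exP) => d /asboolP[U [sU xU dU]] dmin.
exists U; split => // W sW xW.
have /dmin : P (\dim (U :&: W)%VS).
  apply/asboolP; exists (U :&: W)%VS; split => //; last by rewrite memv_cap xU.
  by move=> j y; rewrite !memv_cap => /andP[yU yW]; rewrite sU //= sW.
rewrite -dU => leUW; apply/capv_idPl/eqP.
by rewrite eqEdim capvSl.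
Qed.

Definition generated_submodule x : {vspace quandle_ring K n} :=
  sval (cid (smallest_submodule_exists x)).

Lemma generated_submoduleP x : is_smallest_submodule x (generated_submodule x).
Proof. exact: svalP. Qed.

Definition indecomposable U : Prop :=
  [/\ is_submodule U, U <> 0%VS
    & forall W1 W2, is_submodule W1 -> is_submodule W2 ->
        (W1 + W2)%VS = U -> directv (W1 + W2) -> W1 = 0%VS \/ W2 = 0%VS].

Definition even_span : {vspace quandle_ring K n} :=
  (\sum_(i < n | ~~ odd i) <[qbasis i]>)%VS.

Definition odd_span : {vspace quandle_ring K n} :=
  (\sum_(i < n | odd i) <[qbasis i]>)%VS.

End QuandleRing.

Definition V_triv_even (K : fieldType) (m : nat) :=
  generated_submodule (\sum_(i < m) qbasis K (2 * m) (2 * i)).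

Definition V_triv_odd (K : fieldType) (m : nat) :=
  generated_submodule (\sum_(i < m) qbasis K (2 * m) (2 * i + 1)).

(* Meant for m = 2 * t; [m] and [t] are kept separate so that all the submodules
   live in ['cV_(2 * m)]. *)
Definition V_ref_even (K : fieldType) (m t : nat) :=
  generated_submodule
    (\sum_(i < t) qbasis K (2 * m) (4 * i)
     - \sum_(i < t) qbasis K (2 * m) (4 * i + 2)).

Definition V_ref_odd (K : fieldType) (m t : nat) :=
  generated_submodule
    (\sum_(i < t) qbasis K (2 * m) (4 * i + 1)
     - \sum_(i < t) qbasis K (2 * m) (4 * i + 3)).

(** * Dihedral groups and their representations *)

(* For m > 0, [Dihedral a b] is the element r^a s^b of D_m; ['I_m.-1.+1] is
   ['I_m] with its additive group structure.  (['Z_m] would be wrong for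
   m = 1.) *)
Record dihedral (m : nat) : Type :=
  Dihedral { rot_exp : 'I_m.-1.+1; is_refl : bool }.

Section DihedralGroup.
Variable m : nat.
Implicit Types g h : dihedral m.

Definition dihedral_pair g : 'I_m.-1.+1 * bool := (rot_exp g, is_refl g).
Definition pair_dihedral (p : 'I_m.-1.+1 * bool) : dihedral m :=
  Dihedral p.1 p.2.
Lemma dihedral_pairK : cancel dihedral_pair pair_dihedral.
Proof. by case. Qed.

HB.instance Definition _ := Finite.copy (dihedral m) (can_type dihedral_pairK).

Definition dihedral_mul g h : dihedral m :=
  Dihedral (rot_exp g + (if is_refl g then - rot_exp h else rot_exp h))
           (is_refl g (+) is_refl h).
Definition dihedral_one : dihedral m := Dihedral 0 false.
Definition dihedral_inv g : dihedral m :=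
  Dihedral (if is_refl g then rot_exp g else - rot_exp g) (is_refl g).

Lemma dihedral_mulA : associative dihedral_mul.
Proof.
move=> [a b] [c d] [e f]; rewrite /dihedral_mul /= addbA.
by case: b d => [] []; rewrite /= ?opprD ?opprK addrA.
Qed.

Lemma dihedral_mul1 : left_id dihedral_one dihedral_mul.
Proof. by move=> [a b]; rewrite /dihedral_mul /= add0r. Qed.

Lemma dihedral_mulV : left_inverse dihedral_one dihedral_inv dihedral_mul.
Proof.
by move=> [a []]; rewrite /dihedral_mul /dihedral_one /= ?addrN ?addNr.
Qed.

HB.instance Definition _ := Finite_isGroup.Build (dihedral m)
  dihedral_mulA dihedral_mul1 dihedral_mulV.

Definition dihedral_rot : dihedral m := Dihedral (inord 1) false.
Definition dihedral_refl : dihedral m := Dihedral 0 true.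

End DihedralGroup.

Section DihedralRelations.
Variable m : nat.
Hypothesis m_gt0 : (0 < m)%N.
Local Notation r := (dihedral_rot m).
Local Notation s := (dihedral_refl m).

Lemma card_dihedral : #|{: dihedral m}| = (2 * m)%N.
Proof.
have pairK : cancel (@pair_dihedral m) (@dihedral_pair m) by case.
rewrite (bij_eq_card (Bijective (@dihedral_pairK m) pairK)).
by rewrite card_prod card_ord card_bool prednK // mulnC.
Qed.

Lemma dihedral_rotX k :
  (r ^+ k)%g = Dihedral (inord (k %% m)) false :> dihedral m.
Proof.
have lt a : (a %% m < m.-1.+1)%N by rewrite prednK // ltn_pmod.
elim: k => [|k IHk].
  by rewrite mod0n; congr Dihedral; apply/val_inj; rewrite /= inordK.
rewrite expgS IHk; congr Dihedral; apply/val_inj.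
have [m1|m_neq1] := eqVneq m 1%N.
  have ord0E (x : 'I_m.-1.+1) : val x = 0%N.
    by case: x => -[|x] //=; rewrite m1.
  by rewrite !ord0E.
have m_gt1 : (1 < m.-1.+1)%N by rewrite prednK // ltn_neqAle eq_sym m_neq1.
by rewrite /= !inordK ?lt // prednK // modnDmr add1n.
Qed.

Lemma dihedral_eltE (g : dihedral m) : g = (r ^+ rot_exp g * s ^+ is_refl g)%g.
Proof.
have sE (b : bool) : (s ^+ b)%g = Dihedral 0 b :> dihedral m by case: b.
case: g => a b; rewrite sE dihedral_rotX modn_small; last first.
  by rewrite -[X in (_ < X)%N](prednK m_gt0).
by congr Dihedral; rewrite /= inord_val addr0.
Qed.

Lemma dihedral_relations :
  [/\ (r ^+ m)%g = 1%g, (s ^+ 2)%g = 1%g & (s * r * s^-1)%g = (r^-1)%g].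
Proof.
split.
- rewrite dihedral_rotX modnn; congr Dihedral.
  by apply/val_inj; rewrite /= inordK.
- by congr Dihedral; rewrite /= oppr0 addr0.
- by congr Dihedral; rewrite /= add0r subr0.
Qed.

End DihedralRelations.

Section DihedralAction.
Variables (m : nat) (V : Type).

(* The action of D_m for which the generators r, s of D_m act as [fr], [fs];
   the composition is that of a left action. *)
Definition dihedral_act (fr fs : V -> V) (g : dihedral m) (v : V) : V :=
  iter (rot_exp g) fr (iter (is_refl g) fs v).

Lemma dihedral_actM (fr fs : V -> V) :
  (0 < m)%N -> iter m fr =1 id -> fs \o fs =1 id ->
  fs \o fr \o fs \o fr =1 id ->
  forall g h : dihedral m,
    dihedral_act fr fs (g * h)%g =1 dihedral_act fr fs g \o dihedral_act fr fs h.
Proof.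
move=> m0 frm fss fsr [a b] [c d] v; rewrite /dihedral_act /=.
have iterm k q w : iter (k + q * m) fr w = iter k fr w.
  rewrite iterD; congr (iter k fr _); elim: q => //= q IHq.
  by rewrite mulSn iterD IHq; exact: frm.
have itermod k w : iter (k %% m.-1.+1) fr w = iter k fr w.
  by rewrite prednK // [in RHS](divn_eq k m) addnC iterm.
have frK w : fr (fs (fr w)) = fs w by rewrite -[LHS]fss; congr fs; exact: fsr.
have frsK k w : iter k fr (fs (iter k fr w)) = fs w.
  by elim: k w => // k IHk w; rewrite iterSr [X in fs X]iterS frK IHk.
case: b => /=; rewrite itermod iterD; last by [].
congr (iter a fr _); rewrite itermod; set u := iter d fs v.
have -> : iter (~~ d) fs v = fs u by rewrite /u; case: (d) => //=; rewrite [RHS]fss.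
have cm : (c <= m.-1.+1)%N by rewrite ltnW.
by rewrite -{1}(frsK c u) -iterD subnK // -itermod modnn.
Qed.

End DihedralAction.

(* The subspace [U] of the representation [actV] of [gT] on [V] is a
   subrepresentation isomorphic to the representation [actW] on [W]; the
   conditions on [f] force [U] to be invariant under [actV]. *)
Definition isomorphic_rep (K : fieldType) (gT : finGroupType)
    (V W : vectType K) (actV : gT -> V -> V) (U : {vspace V})
    (actW : gT -> W -> W) : Prop :=
  exists f : 'Hom(W, V),
    [/\ lker f = 0%VS, limg f = U
      & forall g w, f (actW g w) = actV g (f w)].

(* [r] acts as R_1 R_0 (first R_0, then R_1) and [s] as R_0. *)
Definition quandle_ring_act (K : fieldType) (m : nat) :
    dihedral m -> quandle_ring K (2 * m) -> quandle_ring K (2 * m) :=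
  dihedral_act (fun x => right_mul 1 (right_mul 0 x)) (right_mul 0).

(** * The two-dimensional representations over the reals and the complexes *)

Variant scalar_kind := RealScalars | ComplexScalars.

Definition scalars (R : realType) (k : scalar_kind) : fieldType :=
  match k with RealScalars => R | ComplexScalars => R[i] end.

Definition expi (R : realType) (theta : R) : R[i] :=
  Complex (cos theta) (sin theta).

Definition mx2 (T : Type) (a b c d : T) : 'M[T]_2 :=
  \matrix_(i, j) if i == 0 then (if j == 0 then a else b)
                 else (if j == 0 then c else d).

Definition psi_rot (R : realType) (theta : R) (k : scalar_kind) (j : nat) :
    'M[scalars R k]_2 :=
  match k with
  | RealScalars =>
      mx2 (cos (j%:R * theta)) (- sin (j%:R * theta))
          (sin (j%:R * theta)) (cos (j%:R * theta))
  | ComplexScalars => mx2 (expi theta ^+ j) 0 0 (expi theta ^- j)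
  end.

Definition psi_refl (R : realType) (k : scalar_kind) : 'M[scalars R k]_2 :=
  match k with
  | RealScalars => mx2 1 0 0 (-1)
  | ComplexScalars => mx2 0 1 1 0
  end.

Definition psi (R : realType) (theta : R) (k : scalar_kind) (m j : nat) :
    dihedral m -> 'cV[scalars R k]_2 -> 'cV[scalars R k]_2 :=
  dihedral_act (mulmx (psi_rot theta k j)) (mulmx (psi_refl R k)).

Arguments psi {R} theta k {m} j _ _.

(* Main.v *)
(** A vector of the quandle ring is a function on Z/2m, on which R_k acts by
    x(i) |-> x(2k - i). The functions i |-> exp(+- i j theta / 2), cut off to
    one parity class of positions, span a copy of psi_j for 0 < j < m/2, and a line
    for j = 0 and j = m/2, namely V_triv and V_ref. By the inversion formula of
    the discrete Fourier transform all these spaces together span the quandle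
    ring (the frequencies j and m - j give the same space), and their dimensions
    add up to 2m, so the sum is direct. The two-dimensional spaces are
    indecomposable: on a one-dimensional submodule every R_k is a sign, so on a
    sum of two of them (R_1 R_0)^2 = 1, whereas psi_j(r)^2 <> 1. *)

Require Import Defs.
From mathcomp Require Import all_boot all_order all_algebra all_fingroup.
From mathcomp Require Import complex.
From mathcomp Require Import boolp reals trigo.
From mathcomp Require Import ring lra zify.
Set Implicit Arguments.
Unset Strict Implicit.
Unset Printing Implicit Defensive.
Import Order.TTheory GRing.Theory Num.Theory.
Local Open Scope ring_scope.

(** * Right multiplications and lines in the quandle ring *)

Lemma quandle_opK (n : nat) (k i : 'I_n) : (i |> k) |> k = i.
Proof.
apply/val_inj => /=; set a := (2 * k + (n - i))%N.
have n0 : (0 < n)%N by apply: leq_ltn_trans (ltn_ord i).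
have -> : nat_of_ord i = (i %% n)%N by rewrite modn_small.
(* Adding [a] cancels the subtractions: both sides become [2 * k + n]. *)
apply/eqP; rewrite -(eqn_modDl a) -(modnDml a) addnCA subnKC; last first.
  by rewrite ltnW // ltn_pmod.
by rewrite /a -addnA subnK // ltnW.
Qed.

Section RightModules.
Variables (K : fieldType) (n : nat).
Implicit Types (x y : quandle_ring K n) (U W : {vspace quandle_ring K n}).

(** Moving basis vectors along the involution [_ |> k] amounts to pulling coordinates back along it;
    vectors can then be handled as functions of the position. *)
Lemma right_mulE (k : 'I_n) x i : right_mul k x i 0 = x (i |> k) 0.
Proof.
have deltaE (i1 i2 : 'I_n) : qbasis K n i2 i1 0 = (i1 == i2)%:R.
  by rewrite /qbasis mxE (inj_eq val_inj).
have -> : right_mul k x = \sum_(j < n) x j 0 *: qbasis K n (j |> k).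
  apply: eq_bigr => j _; rewrite (bigD1 k) //= deltaE eqxx mulr1 big1 ?addr0 //.
  by move=> l /negPf lk; rewrite deltaE lk mulr0 scale0r.
rewrite summxE (bigD1 (i |> k)) // mxE deltaE quandle_opK eqxx mulr1.
rewrite big1 => [|j ji]; first exact: addr0.
rewrite mxE deltaE; case: (i =P j |> k) ji => [->|_ _]; last exact: mulr0.
by rewrite quandle_opK eqxx.
Qed.

Lemma right_mulK (k : 'I_n) x : right_mul k (right_mul k x) = x.
Proof. by apply/colP=> i; rewrite !right_mulE quandle_opK. Qed.

Lemma right_mulZ (k : 'I_n) a x : right_mul k (a *: x) = a *: right_mul k x.
Proof. by apply/colP=> i; rewrite !mxE !right_mulE !mxE. Qed.

Lemma right_mulD (k : 'I_n) x y :
  right_mul k (x + y) = right_mul k x + right_mul k y.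
Proof. by apply/colP=> i; rewrite !mxE !right_mulE !mxE. Qed.

Lemma right_mul0 (k : 'I_n) : right_mul k 0 = 0 :> quandle_ring K n.
Proof. by apply/colP=> i; rewrite !right_mulE !mxE. Qed.

Lemma line_submodule x :
  (forall k : 'I_n, right_mul k x \in <[x]>%VS) -> is_submodule <[x]>%VS.
Proof.
by move=> xP k _ /vlineP[a ->]; rewrite right_mulZ memvZ.
Qed.

Lemma generated_submodule_line x :
  (forall k : 'I_n, right_mul k x \in <[x]>%VS) ->
  generated_submodule x = <[x]>%VS.
Proof.
move=> /line_submodule xP; have [sU xU minU] := generated_submoduleP x.
by apply/eqP; rewrite eqEsubv minU ?memv_line //.
Qed.

Lemma line_indecomposable x :
  x != 0 -> is_submodule <[x]>%VS -> indecomposable <[x]>%VS.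
Proof.
move=> x0 sx; split=> //; first by move/eqP; rewrite -dimv_eq0 dim_vline x0.
move=> W1 W2 _ _ W12; rewrite directvE /= W12 dim_vline x0 => /eqP.
case: (\dim W1) (dimv_eq0 W1) => [/esym/eqP|d1 _]; first by left.
case: (\dim W2) (dimv_eq0 W2) => [/esym/eqP|d2 _]; first by right.
by rewrite addSn addnS.
Qed.

(* A submodule of dimension one is a line on which each [R_k], being an
   involution, acts by a sign. *)
Lemma dim1_right_mul_square W (k l : 'I_n) x :
  is_submodule W -> \dim W = 1%N -> x \in W ->
  right_mul k (right_mul l (right_mul k (right_mul l x))) = x.
Proof.
move=> sW dW xW; have [->|x0] := eqVneq x 0; first by rewrite !right_mul0.
have WE : W = <[x]>%VS.
  apply/esym/eqP; rewrite eqEdim dW dim_vline x0 andbT.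
  by apply/subvP => _ /vlineP[a ->]; rewrite memvZ.
have lineP (h : 'I_n) : exists2 a, right_mul h x = a *: x & a * a *: x = x.
  have /vlineP[a ax] : right_mul h x \in <[x]>%VS by rewrite -WE; apply: sW.
  by exists a => //; rewrite -scalerA -!(ax, right_mulZ) right_mulK.
have [a ax aax] := lineP k; have [b bx bbx] := lineP l.
rewrite !(bx, ax, right_mulZ) !scalerA -[RHS]aax -[X in _ = _ *: X]bbx scalerA.
by congr (_ *: _); ring.
Qed.

End RightModules.

(** * Submodules spanned by harmonics *)

(* [har j z] is the row of values at position [z] of the two [j]-th harmonics,
   and [dual] realises the inversion formula of the discrete Fourier transform.
   In [har_fold] the scalar depends on the parity of the position because
   [har j] has half the frequency of [A j]. *)
Record harmonics (K : fieldType) (m : nat) (A : nat -> 'M[K]_2) (S : 'M[K]_2) :=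
  Harmonics {
  har : nat -> int -> 'rV[K]_2;
  dual : nat -> int -> 'cV[K]_2;
  har_rot : forall j z, har j (z - 2) = har j z *m A j;
  har_refl : forall j z, har j (- z) = har j z *m S;
  har_period : forall j z, har j (z + (2 * m)%:Z) = har j z;
  har_fold : forall j (b : bool), (j <= m)%N -> exists c, forall q : nat,
    har (m - j) (2 * q + b)%N = c *: (har j (2 * q + b)%N *m S);
  har_dual : forall i l : 'I_(2 * m), odd i = odd l ->
    \sum_(j < m) (har j i *m dual j l) = (i == l)%:R%:M;
  har_neq0 : forall j z, har j z != 0;
  har_inj : forall j z w, (0 < j)%N -> (2 * j < m)%N ->
    har j z *m w = 0 -> har j (z + 2) *m w = 0 -> w = 0 :> 'cV_2;
  refl_square : S *m S = 1%:M;
  rotation0 : A 0%N = 1%:M;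
  rot_half : forall t, (0 < m)%N -> m = (2 * t)%N -> A t = (-1)%:M;
  rot_square : forall j, (0 < j)%N -> (2 * j < m)%N -> A j *m A j != 1%:M }.

Section Waves.
Variables (K : fieldType) (m : nat) (A : nat -> 'M[K]_2) (S : 'M[K]_2).
Hypothesis m_gt0 : (0 < m)%N.
Variable H : harmonics m A S.
Local Notation n := (2 * m)%N.
Implicit Types (b : bool) (w : 'cV[K]_2).

(** As a map from ['cV_2], this intertwines the matrices [A j] and [S] with R_1 R_0 and R_0. *)
Definition wave b j : 'M[K]_(n, 2) :=
  \matrix_(i, c) ((odd i == b)%:R * har H j i 0 c).

Lemma waveE b j w i :
  (wave b j *m w) i 0 = (odd i == b)%:R * (har H j i *m w) 0 0.
Proof.
by rewrite !mxE mulr_sumr; apply: eq_bigr => c _; rewrite !mxE mulrA.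
Qed.

Lemma har_modn j a : har H j (a %% n)%N = har H j a.
Proof.
rewrite [in RHS](divn_eq a n); elim: (a %/ n)%N => // q IHq.
by rewrite (mulSn q) -addnA addnC PoszD har_period.
Qed.

Lemma har_rotX j z k : har H j (z - (2 * k)%:Z) = har H j z *m A j ^+ k.
Proof.
elim: k => [|k IHk]; first by rewrite muln0 subr0 expr0 mulmx1.
by rewrite mulnS addnC PoszD opprD addrA har_rot IHk exprSr mulmxA.
Qed.

(** R_k relates position z to 2k - z = -(z - 2k): [k] backward translations by 2, then a negation.
    Parity is kept because the modulus is even. *)
Lemma right_mul_wave b j w k : (k < n)%N ->
  right_mul k (wave b j *m w) = wave b j *m (A j ^+ k *m S *m w).
Proof.
move=> kn; apply/colP => i; rewrite (right_mulE (Ordinal kn)) !waveE.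
have i_lt := ltn_ord i.
have -> : odd (i |> Ordinal kn) = odd i by rewrite /=; lia.
rewrite /= har_modn !mulmxA -har_rotX -har_refl; congr (_ * (_ *m _) 0 0).
by rewrite opprB -(har_period H _ (_ - _)); congr (har H j _); lia.
Qed.

Definition wave_map b j : 'Hom('cV[K]_2, quandle_ring K n) :=
  linfun (mulmx (wave b j)).

Lemma wave_mapE b j w : wave_map b j w = wave b j *m w.
Proof. by rewrite lfunE. Qed.

Definition wave_space b j := limg (wave_map b j).

Lemma wave_spaceP b j x :
  reflect (exists w, x = wave b j *m w) (x \in wave_space b j).
Proof.
by apply: (iffP memv_imgP) => [[w _ ->]|[w ->]]; exists w;
  rewrite ?wave_mapE ?memvf.
Qed.

Lemma wave_space_submodule b j : is_submodule (wave_space b j).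
Proof.
move=> k _ /wave_spaceP[w ->]; apply/wave_spaceP; rewrite right_mul_wave //.
by eexists.
Qed.

Lemma wave_inj b j : (0 < j)%N -> (2 * j < m)%N ->
  injective (fun w => wave b j *m w).
Proof.
move=> j0 jm w1 w2 /eqP; rewrite -subr_eq0 -mulmxBr => /eqP w0.
apply/eqP; rewrite -subr_eq0; apply/eqP.
have at_pos i : (i < n)%N -> odd i = b -> har H j i *m (w1 - w2) = 0.
  move=> i_lt ib; apply/rowP => c; rewrite ord1 [RHS]mxE.
  have := waveE b j (w1 - w2) (Ordinal i_lt).
  by rewrite w0 [LHS]mxE /= ib eqxx mul1r => <-.
(* The positions [b] and [b + 2] have the right parity and are in range, since the bounds on [j]
   give m > 2. *)
apply: (har_inj (h := H) (z := b%:Z) j0 jm).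
  by apply: at_pos; last exact: oddb; case: (b); lia.
by rewrite -PoszD; apply: at_pos; rewrite ?oddD ?oddb ?addbF //; case: (b); lia.
Qed.

Lemma wave_lker b j : (0 < j)%N -> (2 * j < m)%N ->
  lker (wave_map b j) = 0%VS.
Proof.
move=> j0 jm; apply/eqP/lker0P => w1 w2; rewrite !wave_mapE.
exact: (wave_inj j0 jm).
Qed.

Lemma wave_space_dim b j : (0 < j)%N -> (2 * j < m)%N ->
  \dim (wave_space b j) = 2.
Proof.
move=> j0 jm; rewrite limg_dim_eq ?dimvf ?dim_matrix //.
by rewrite wave_lker // capv0.
Qed.

Lemma wave_refl b j w : wave b j *m (S *m w) = right_mul 0 (wave b j *m w).
Proof. by rewrite right_mul_wave ?expr0 ?mul1mx //; lia. Qed.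

(** R_0 acts by [S] and R_1 by [A j *m S], so in R_1 R_0 the two factors [S] cancel. *)
Lemma wave_rot b j w :
  wave b j *m (A j *m w) = right_mul 1 (right_mul 0 (wave b j *m w)).
Proof.
rewrite -wave_refl right_mul_wave ?expr1; last by lia.
by rewrite -(mulmxA (A j)) (mulmxA S) (refl_square H) mul1mx.
Qed.

Lemma wave_space_rep b j : (0 < j)%N -> (2 * j < m)%N ->
  isomorphic_rep (@quandle_ring_act K m) (wave_space b j)
    (fun g w => dihedral_act (mulmx (A j)) (mulmx S) g w : 'cV_2).
Proof.
move=> j0 jm; exists (wave_map b j); split => //.
  exact: wave_lker.
move=> [a e] w; rewrite /quandle_ring_act /dihedral_act /= wave_mapE.
elim: (nat_of_ord a) => [|a' IHa] /=; last by rewrite wave_rot IHa.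
by case: e => //=; rewrite wave_mapE ?wave_refl.
Qed.

Lemma wave_space_indecomposable b j : (0 < j)%N -> (2 * j < m)%N ->
  indecomposable (wave_space b j).
Proof.
move=> j0 jm; split; first exact: wave_space_submodule.
  by move/eqP; rewrite -dimv_eq0 wave_space_dim.
move=> W1 W2 sW1 sW2 W12; rewrite directvE /= W12 wave_space_dim // => /eqP dW.
have [->|W1n0] := eqVneq W1 0%VS; first by left.
have [->|W2n0] := eqVneq W2 0%VS; first by right.
have [dW1 dW2] : \dim W1 = 1%N /\ \dim W2 = 1%N.
  by move: W1n0 W2n0; rewrite -!dimv_eq0; lia.
have n0 : (0 < n)%N by lia.
have n1 : (1 < n)%N by lia.
pose o0 := Ordinal n0; pose o1 := Ordinal n1.
(* This would contradict [rot_square]; through the injective wave map the square of [A j] becomes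
   (R_1 R_0)^2. *)
suff /eqP : A j *m A j = 1%:M by rewrite (negPf (rot_square H j0 jm)).
apply/matrixP => i c; suff AAw w : A j *m A j *m w = w.
  have /colP/(_ i) := AAw (delta_mx c 0); rewrite -colE mxE => ->.
  by rewrite !mxE eqxx andbT.
apply: (@wave_inj b j j0 jm) => /=.
rewrite -mulmxA !wave_rot.
have : wave b j *m w \in (W1 + W2)%VS.
  by rewrite W12; apply/wave_spaceP; exists w.
case/memv_addP=> x1 x1W [x2 x2W ->].
(* The indices 0 and 1 are turned into ordinals, for which [right_mul] is additive. *)
rewrite -[1%N]/(nat_of_ord o1) -[0%N]/(nat_of_ord o0) !right_mulD.
rewrite (dim1_right_mul_square _ _ sW1 dW1 x1W).
by rewrite (dim1_right_mul_square _ _ sW2 dW2 x2W).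
Qed.

End Waves.

(** * Coordinates of the generators of V_triv and V_ref *)

Lemma qbasis_sum (K : fieldType) (n : nat) (x : quandle_ring K n) :
  x = \sum_(l < n) x l 0 *: qbasis K n l.
Proof.
apply/colP => i; rewrite summxE (bigD1 i) //= !mxE eqxx mulr1.
rewrite big1 ?addr0 // => l.
by rewrite !mxE (inj_eq val_inj) eq_sym => /negPf ->; rewrite mulr0.
Qed.

(** By Euclidean division only the index [l %/ d] can contribute; the bound on [l] keeps it below
    [c]. *)
Lemma sum_qbasis_progression (K : fieldType) (n d c r : nat) (l : 'I_n) :
  (l < d * c)%N -> (r < d)%N ->
  (\sum_(i < c) qbasis K n (d * i + r)) l 0 = (l %% d == r)%N%:R.
Proof.
move=> lc rd; have d0 : (0 < d)%N by lia.
have entryE (i : 'I_c) :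
    qbasis K n (d * i + r) l 0 = ((l %% d == r) && (l %/ d == i))%N%:R.
  rewrite /qbasis mxE; congr (_%:R); congr nat_of_bool; apply/eqP/andP.
    move=> /= ->; rewrite mulnC modnMDl divnMDl // modn_small //.
    by rewrite divn_small // addn0 !eqxx.
  by case=> /eqP <- /eqP <-; rewrite mulnC -divn_eq.
have li : (l %/ d < c)%N by rewrite ltn_divLR // mulnC.
rewrite summxE (bigD1 (Ordinal li)) // entryE eqxx andbT big1 => [|i].
  exact: addr0.
by rewrite entryE eq_sym -val_eqE /= => /negPf ->; rewrite andbF.
Qed.

Section Lines.
Variables (K : fieldType) (m : nat).
Local Notation n := (2 * m)%N.

(** Position [2 * q + b] carries [s ^+ q]: [s = 1] gives the generators of V_triv and [s = -1] those
    of V_ref. *)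
Definition sign_vec (b : bool) (s : K) : quandle_ring K n :=
  \col_l ((odd l == b)%:R * s ^+ l./2).

Lemma triv_vecE (b : bool) : \sum_(i < m) qbasis K n (2 * i + b) = sign_vec b 1.
Proof.
apply/colP => l; rewrite sum_qbasis_progression ?ltn_ord //; last by case: b.
by rewrite mxE expr1n mulr1 modn2; case: odd b => [] [].
Qed.

Lemma ref_vecE (b : bool) t : m = (2 * t)%N ->
  \sum_(i < t) qbasis K n (4 * i + b)
    - \sum_(i < t) qbasis K n (4 * i + (2 + b))
  = sign_vec b (-1).
Proof.
move=> mt; apply/colP => l; rewrite mxE [X in _ + X]mxE.
have l_lt : (l < 4 * t)%N by have := ltn_ord l; lia.
rewrite !sum_qbasis_progression //; try by case: b.
rewrite mxE -signr_odd.
(* Both signs depend only on the residue of [l] modulo 4. *)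
have -> : odd l = odd (l %% 4) by lia.
have -> : odd l./2 = (1 < l %% 4)%N by lia.
have : (l %% 4 < 4)%N by rewrite ltn_pmod.
by case: (l %% 4)%N b => [|[|[|[|]]]] // [] _;
  rewrite /= ?expr0 ?expr1 ?mul1r ?mul0r ?subr0 ?sub0r ?mulr1.
Qed.

Lemma sign_vec_neq0 b s : (0 < m)%N -> sign_vec b s != 0.
Proof.
move=> m0; have bn : (b < n)%N by case: b; lia.
apply/negP => /eqP/colP/(_ (Ordinal bn)); rewrite !mxE /= oddb eqxx mul1r.
have -> : (b./2 = 0)%N by case: b {bn}.
by rewrite expr0 => /eqP; rewrite oner_eq0.
Qed.

End Lines.

(** * Degenerate frequencies, folding and spanning *)

Section Decomposition.
Variables (K : fieldType) (m : nat) (A : nat -> 'M[K]_2) (S : 'M[K]_2).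
Hypothesis m_gt0 : (0 < m)%N.
Variable H : harmonics m A S.
Local Notation n := (2 * m)%N.
Local Notation V := (wave_space H).
Implicit Types (b : bool) (w : 'cV[K]_2).

(** When [A j] is a sign [s], moving by 2 multiplies both harmonics by [s], so on a parity class
    both are multiples of one sign vector. *)
Lemma wave_space_line b j s : s * s = 1 -> A j = s%:M ->
  V b j = <[sign_vec m b s]>%VS.
Proof.
move=> ss As.
have harE q : har H j (2 * q + b)%N = s ^+ q *: har H j b.
  elim: q => [|q IHq]; first by rewrite expr0 scale1r.
  have := har_rot H j (2 * q.+1 + b)%N; rewrite As mul_mx_scalar.
  (* [har_rot] steps backwards; multiplying by [s], its own inverse, turns this into a forward
     step. *)
  move/(congr1 (fun x => s *: x)); rewrite scalerA ss scale1r => <-.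
  by rewrite exprS -scalerA -IHq; congr (_ *: har H j _); lia.
have waveE' w : wave H b j *m w = (har H j b *m w) 0 0 *: sign_vec m b s.
  apply/colP => l; rewrite waveE [RHS]mxE [sign_vec _ _ _ _ _]mxE.
  case: eqP => [lb|_]; last by rewrite !mul0r mulr0.
  rewrite !mul1r -[in LHS](odd_double_half l) addnC -mul2n lb harE.
  by rewrite -scalemxAl mxE mulrC.
apply/eqP; rewrite eqEsubv; apply/andP; split; apply/subvP => x.
  by case/wave_spaceP=> w ->; rewrite waveE' memvZ ?memv_line.
case/vlineP=> a ->; apply: memvZ; apply/wave_spaceP.
(* A nonzero entry of [har] at position [b] gives the coordinates that produce the sign vector
   itself. *)
have /existsP[c hc] : [exists c, har H j b 0 c != 0].
  rewrite -negb_forall; apply/negP => /forallP h0.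
  have /negP[] := har_neq0 H j b; apply/eqP/rowP => c.
  by rewrite mxE; apply/eqP/h0.
exists ((har H j b 0 c)^-1 *: delta_mx c 0); rewrite waveE' -scalemxAr -colE.
by rewrite !mxE mulVf // scale1r.
Qed.

Lemma generated_sign_vec b j s : s * s = 1 -> A j = s%:M ->
  generated_submodule (sign_vec m b s) = V b j.
Proof.
move=> ss As; have VE := wave_space_line b ss As; rewrite VE.
apply: generated_submodule_line => k.
have := wave_space_submodule m_gt0 (H := H) (b := b) (j := j) k.
by rewrite VE => /(_ _ (memv_line _)).
Qed.

Lemma sign_space_indecomposable b j s : s * s = 1 -> A j = s%:M ->
  indecomposable (V b j).
Proof.
move=> ss As; have : is_submodule (V b j) by exact: wave_space_submodule.
rewrite (wave_space_line b ss As); apply: line_indecomposable.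
exact: sign_vec_neq0.
Qed.

(** The scalar of [har_fold] is constant on a parity class, so it and [S] can be absorbed into the
    coordinates [w]. *)
Lemma wave_space_fold b j : (j <= m)%N -> (V b (m - j) <= V b j)%VS.
Proof.
move=> jm; have [c cP] := har_fold H b jm.
apply/subvP => _ /wave_spaceP[w ->]; apply/wave_spaceP.
exists (c *: (S *m w)); apply/colP => l; rewrite !waveE.
case: eqP => [lb|_]; last by rewrite !mul0r.
rewrite -(odd_double_half l) addnC -mul2n lb cP.
by rewrite -scalemxAl -scalemxAr mulmxA.
Qed.

(** Fourier inversion writes each basis vector with frequencies below [m]; those above m/2 fold down
    to [m - j]. *)
Lemma wave_spaces_span (W : {vspace quandle_ring K n}) :
  (forall b j, (2 * j <= m)%N -> (V b j <= W)%VS) -> W = fullv.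
Proof.
move=> VW; have VW' b j : (j < m)%N -> (V b j <= W)%VS.
  move=> jm; have [|j2] := leqP (2 * j) m; first exact: VW.
  have -> : j = (m - (m - j))%N by lia.
  by apply: subv_trans (wave_space_fold b _) (VW _ _ _); lia.
have basisW (l : 'I_n) : qbasis K n l \in W.
  suff -> : qbasis K n l = \sum_(j < m) wave H (odd l) j *m dual H j l.
    apply: memv_suml => j _; apply: subvP (VW' (odd l) _ (ltn_ord j)) _ _.
    by apply/wave_spaceP; eexists.
  apply/colP => i; rewrite summxE.
  under eq_bigr do rewrite waveE.
  rewrite -mulr_sumr -summxE /qbasis mxE (inj_eq val_inj).
  (* The inversion formula covers equal parities; for unequal ones the cut-off gives 0. *)
  case: (odd i =P odd l) => [/(har_dual H) ->|il]; first by rewrite mul1r mxE.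
  by rewrite mul0r; case: eqP il => [->|].
apply/eqP; rewrite eqEsubv subvf; apply/subvP => x _.
by rewrite (qbasis_sum x); apply: memv_suml => l _; apply: memvZ.
Qed.

Lemma wave_space_parity b j :
  (V b j <= \sum_(i < n | odd i == b) <[qbasis K n i]>)%VS.
Proof.
apply/subvP => _ /wave_spaceP[w ->]; rewrite (qbasis_sum (_ *m w)).
rewrite (bigID (fun i : 'I_n => odd i == b)) /= [X in _ + X]big1 ?addr0.
  by apply: memv_sumr => i _; rewrite memvZ ?memv_line.
by move=> i /negPf ib; rewrite waveE ib mul0r scale0r.
Qed.

Lemma wave_space_even j : (V false j <= even_span K n)%VS.
Proof.
rewrite /even_span (eq_bigl (fun i : 'I_n => odd i == false)).
  exact: wave_space_parity.
by move=> i; rewrite eqbF_neg.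
Qed.

Lemma wave_space_odd j : (V true j <= odd_span K n)%VS.
Proof.
rewrite /odd_span (eq_bigl (fun i : 'I_n => odd i == true)).
  exact: wave_space_parity.
by move=> i; rewrite eqb_id.
Qed.

End Decomposition.

Lemma mulN1N1 (R : pzRingType) : (-1) * (-1) = 1 :> R.
Proof. by rewrite mulrNN mulr1. Qed.

(** * Identification of the summands, their dimensions and their sum *)

Section InternalSum.
Variables (K : fieldType) (m : nat) (A : nat -> 'M[K]_2) (S : 'M[K]_2).
Hypothesis m_gt0 : (0 < m)%N.
Variable H : harmonics m A S.
Local Notation n := (2 * m)%N.
Local Notation V := (wave_space H).

Lemma V_triv_evenE : V_triv_even K m = V false 0.
Proof.
rewrite -(generated_sign_vec m_gt0 H false (mulr1 1) (rotation0 H)) -triv_vecE.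
by congr generated_submodule; apply: eq_bigr => i _; rewrite addn0.
Qed.

Lemma V_triv_oddE : V_triv_odd K m = V true 0.
Proof.
rewrite -(generated_sign_vec m_gt0 H true (mulr1 1) (rotation0 H)).
by rewrite -triv_vecE.
Qed.

Lemma V_ref_evenE t : m = (2 * t)%N -> V_ref_even K m t = V false t.
Proof.
move=> mt; have At := rot_half H m_gt0 mt.
rewrite -(generated_sign_vec m_gt0 H false (mulN1N1 K) At) -(ref_vecE _ _ mt).
by congr (generated_submodule (_ - _)); apply: eq_bigr => i _; rewrite ?addn0.
Qed.

Lemma V_ref_oddE t : m = (2 * t)%N -> V_ref_odd K m t = V true t.
Proof.
move=> mt; have At := rot_half H m_gt0 mt.
by rewrite -(generated_sign_vec m_gt0 H true (mulN1N1 K) At) -(ref_vecE _ _ mt).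
Qed.

Lemma wave_space0_dim b : \dim (V b 0) = 1%N.
Proof.
rewrite (wave_space_line m_gt0 H b (mulr1 1) (rotation0 H)).
by rewrite dim_vline sign_vec_neq0.
Qed.

Lemma wave_space_half_dim b t : m = (2 * t)%N -> \dim (V b t) = 1%N.
Proof.
move=> mt.
rewrite (wave_space_line m_gt0 H b (mulN1N1 K) (rot_half H m_gt0 mt)).
by rewrite dim_vline sign_vec_neq0.
Qed.

(** The bound ensures [2 * j < m] for each index [j < t], so each summand has dimension 2. *)
Lemma wave_space_sum_dim b t : (2 * t < m + 2)%N ->
  (\sum_(1 <= j < t) \dim (V b j) = (t - 1) * 2)%N.
Proof.
move=> tm; rewrite (eq_big_nat _ _ (F2 := fun=> 2)) ?sum_nat_const_nat //.
by move=> j j_int; apply: wave_space_dim; lia.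
Qed.

Lemma subv_wave_sum b t j : (0 < j < t)%N ->
  (V b j <= \sum_(1 <= i < t) V b i)%VS.
Proof.
move=> j_int; rewrite (bigD1_seq j) ?mem_index_iota ?iota_uniq //=.
exact: addvSl.
Qed.

(** For odd [m] no frequency equals m/2, so those up to m/2 are 0 and 1, ..., (m-1)/2. *)
Lemma wave_sum_odd : odd m ->
  (V false 0 + V true 0 + \sum_(1 <= j < (m.-1 %/ 2).+1) V false j
    + \sum_(1 <= j < (m.-1 %/ 2).+1) V true j)%VS = fullv.
Proof.
move=> m_odd; apply: (wave_spaces_span m_gt0 (H := H)) => b [|j] jm.
  do 2!apply: subv_trans (addvSl _ _).
  by case: b; [apply: addvSr|apply: addvSl].
have j_int : (0 < j.+1 < (m.-1 %/ 2).+1)%N by lia.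
apply: subv_trans (subv_wave_sum b j_int) _.
by case: b; [|apply: subv_trans (addvSl _ _)]; apply: addvSr.
Qed.

Lemma wave_sum_even t : m = (2 * t)%N ->
  (V false 0 + V true 0 + V false t + V true t
    + \sum_(1 <= j < t) V false j + \sum_(1 <= j < t) V true j)%VS = fullv.
Proof.
move=> mt; apply: (wave_spaces_span m_gt0 (H := H)) => b j jm.
have [->|j0] := eqVneq j 0%N.
  do 4!apply: subv_trans (addvSl _ _).
  by case: b; [apply: addvSr|apply: addvSl].
have [->|jt] := eqVneq j t.
  do 2!apply: subv_trans (addvSl _ _).
  by case: b; [|apply: subv_trans (addvSl _ _)]; apply: addvSr.
have j_int : (0 < j < t)%N by lia.
apply: subv_trans (subv_wave_sum b j_int) _.
by case: b; [|apply: subv_trans (addvSl _ _)]; apply: addvSr.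
Qed.

End InternalSum.

(** * Real and complex harmonics *)

Section TwoByTwo.
Variable F : fieldType.
Implicit Types (a b c d : F).

Definition row2 a b : 'rV[F]_2 := \row_j if j == 0 then a else b.
Definition col2 a b : 'cV[F]_2 := \col_i if i == 0 then a else b.

Lemma big_ord2 (G : 'I_2 -> F) : \sum_i G i = G 0 + G 1.
Proof.
by rewrite !big_ord_recl big_ord0 addr0; congr (_ + G _); apply/val_inj.
Qed.

Lemma ord2P (P : 'I_2 -> Prop) : P 0 -> P 1 -> forall i, P i.
Proof.
move=> P0 P1 [[|[|//]] i].
  by rewrite (_ : Ordinal i = 0) //; apply/val_inj.
by rewrite (_ : Ordinal i = 1) //; apply/val_inj.
Qed.

Lemma row2_mx2 a b (p q r s : F) :
  row2 a b *m mx2 p q r s = row2 (a * p + b * r) (a * q + b * s).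
Proof. by apply/rowP; apply: ord2P; rewrite !mxE big_ord2 !mxE. Qed.

Lemma row2_cV a b (w : 'cV[F]_2) : (row2 a b *m w) 0 0 = a * w 0 0 + b * w 1 0.
Proof. by rewrite !mxE big_ord2 !mxE. Qed.

Lemma row2_col2 a b c d : row2 a b *m col2 c d = (a * c + b * d)%:M.
Proof.
by apply/rowP => i; rewrite (ord1 i) row2_cV !mxE.
Qed.

Lemma mx2_mul (a1 b1 c1 d1 a2 b2 c2 d2 : F) :
  mx2 a1 b1 c1 d1 *m mx2 a2 b2 c2 d2 =
  mx2 (a1 * a2 + b1 * c2) (a1 * b2 + b1 * d2)
      (c1 * a2 + d1 * c2) (c1 * b2 + d1 * d2).
Proof.
by apply/matrixP; apply: ord2P; apply: ord2P; rewrite !mxE big_ord2 !mxE.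
Qed.

Lemma mx2_scalar a : mx2 a 0 0 a = a%:M.
Proof. by apply/matrixP; apply: ord2P; apply: ord2P; rewrite !mxE. Qed.

Lemma scale_row2 a b c : c *: row2 a b = row2 (c * a) (c * b).
Proof. by apply/rowP; apply: ord2P; rewrite !mxE. Qed.

Lemma row2_eq0 a b : (row2 a b == 0) = (a == 0) && (b == 0).
Proof.
apply/eqP/andP => [/rowP ab|[/eqP -> /eqP ->]].
  by have := ab 0; have := ab 1; rewrite !mxE /= => -> ->.
by apply/rowP; apply: ord2P; rewrite !mxE.
Qed.

End TwoByTwo.

(** * Exponentials on the unit circle *)

Section Expi.
Variable R : realType.
Implicit Types x y : R.

Lemma expiD x y : expi (x + y) = expi x * expi y.
Proof.
rewrite /expi cosD sinD; apply/eqP.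
by rewrite eq_complex /= addrC eqxx addrC eqxx.
Qed.

Lemma expi0 : expi 0 = 1 :> R[i].
Proof. by rewrite /expi cos0 sin0. Qed.

Lemma expiNM x : expi (- x) * expi x = 1.
Proof. by rewrite -expiD addNr expi0. Qed.

Lemma expi_neq0 x : expi x != 0.
Proof.
by apply/eqP => x0; have /esym/eqP := expiNM x; rewrite x0 mulr0 oner_eq0.
Qed.

Lemma expiN x : expi (- x) = (expi x)^-1.
Proof. by apply: (mulIf (expi_neq0 x)); rewrite expiNM mulVf ?expi_neq0. Qed.

Lemma expi_nat x k : expi (k%:R * x) = expi x ^+ k.
Proof.
elim: k => [|k IHk]; first by rewrite mul0r expi0 expr0.
by rewrite mulrSr mulrDl mul1r expiD IHk exprSr.
Qed.

End Expi.

(** * Half-angle harmonics and Fourier inversion *)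

Section HalfAngle.
Variables (R : realType) (m : nat) (theta : R).
Hypothesis m_gt0 : (0 < m)%N.
Hypothesis theta_prim : m.-primitive_root (expi theta).

(* Since [r = R_1 R_0] translates positions by 2, the rotation by [j theta] is
   spread over two steps. *)
Definition half_angle (j : nat) (z : int) : R := z%:~R * (j%:R * theta / 2).
Local Notation x := half_angle.

Lemma expi_full_turn k : expi (k%:R * (m%:R * theta)) = 1.
Proof. by rewrite !expi_nat (prim_expr_order theta_prim) expr1n. Qed.

(** Twice the angle is [b] times the full turn [m * theta], so this exponential is a sign; it
    becomes the scalar of [har_fold]. *)
Lemma expi_half_turn (b : bool) :
  expi (b%:R * (m%:R * theta / 2)) * expi (b%:R * (m%:R * theta / 2)) = 1.
Proof.
rewrite -expiD -[RHS](expi_full_turn b); congr expi.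
by rewrite -mulrDr -splitr.
Qed.

Lemma expi_full_turnN k : expi (- (k%:R * (m%:R * theta))) = 1.
Proof. by rewrite expiN expi_full_turn invr1. Qed.

Lemma expi_half_turnN (b : bool) :
  expi (- (b%:R * (m%:R * theta / 2))) = expi (b%:R * (m%:R * theta / 2)).
Proof.
by apply: (mulIf (expi_neq0 (b%:R * (m%:R * theta / 2))));
  rewrite expiNM expi_half_turn.
Qed.

Lemma half_angleB2 j z : x j (z - 2) = x j z - j%:R * theta.
Proof. by rewrite /half_angle rmorphB /= mulrBl; congr (_ - _); field. Qed.

Lemma half_angleD2 j z : x j (z + 2) = x j z + j%:R * theta.
Proof. by rewrite /half_angle rmorphD /= mulrDl; congr (_ + _); field. Qed.

Lemma half_angleN j z : x j (- z) = - x j z.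
Proof. by rewrite /half_angle rmorphN mulNr. Qed.

Lemma half_angle_period j z :
  x j (z + (2 * m)%:Z) = x j z + j%:R * (m%:R * theta).
Proof.
rewrite /half_angle rmorphD /= mulrDl; congr (_ + _).
by rewrite PoszM rmorphM /= -!pmulrn; field.
Qed.

Lemma half_angle_fold j (b : bool) (q : nat) : (j <= m)%N ->
  x (m - j) (2 * q + b)%N =
  q%:R * (m%:R * theta) + b%:R * (m%:R * theta / 2) - x j (2 * q + b)%N.
Proof.
move=> jm; rewrite /half_angle natrB // -!pmulrn natrD natrM.
by field.
Qed.

(** For equal parities (l - i)/2 is the integer [l./2 - i./2], so this is a geometric sum of powers
    of an m-th root of unity. *)
Lemma sum_expi (i l : 'I_(2 * m)) : odd i = odd l ->
  \sum_(j < m) expi (x j l - x j i) = m%:R * (i == l)%:R.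
Proof.
move=> il; pose z := expi theta ^+ l./2 / expi theta ^+ i./2.
have expE (j : 'I_m) : expi (x j l - x j i) = z ^+ j.
  rewrite /z -!expi_nat -expiN -expiD -expi_nat; congr expi.
  rewrite /half_angle -!pmulrn.
  rewrite -{1}(odd_double_half l) -{1}(odd_double_half i) il.
  by rewrite !natrD -!muln2 !natrM; field.
under eq_bigr do rewrite expE.
have [ile|ine] := eqVneq i l.
  rewrite mulr1 (_ : z = 1); last first.
    by rewrite /z ile divff // expf_neq0 ?expi_neq0.
  under eq_bigr do rewrite expr1n.
  by rewrite sumr_const card_ord.
rewrite mulr0; apply/eqP.
(* [z = 1] would force [l./2 = i./2], both being below [m], and then [l = i] by parity. *)
have z1 : z - 1 != 0.
  rewrite subr_eq0; apply: contra ine => /eqP zz.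
  have /eqP : expi theta ^+ l./2 = expi theta ^+ i./2.
    by rewrite -[LHS](divfK (expf_neq0 i./2 (expi_neq0 theta))) -/z zz mul1r.
  rewrite (eq_prim_root_expr theta_prim) !modn_small; last 2 first.
  - by have := ltn_ord i; lia.
  - by have := ltn_ord l; lia.
  by move=> /eqP li; apply/eqP/val_inj; rewrite /=; lia.
(* [z - 1] times the sum is [z ^+ m - 1 = 0]. *)
rewrite -(mulrI_eq0 _ (mulfI z1)) -subrX1 subr_eq0; apply/eqP.
rewrite /z expr_div_n !(exprAC _ _ m) (prim_expr_order theta_prim).
by rewrite !expr1n divr1.
Qed.

Lemma expi_double_neq1 j : (0 < j)%N -> (2 * j < m)%N ->
  expi theta ^+ j * expi theta ^+ j != 1.
Proof.
move=> j0 jm; rewrite -exprD addnn -mul2n -(prim_order_dvd theta_prim).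
by apply/negP => /dvdn_leq; lia.
Qed.

(** The power squares to 1, and it is not 1 because 0 < t < m. *)
Lemma expi_half t : m = (2 * t)%N -> expi theta ^+ t = -1.
Proof.
move=> mt; have := prim_expr_order theta_prim; rewrite {1}mt mulnC exprM.
move/eqP; rewrite sqrf_eq1 => /orP[|/eqP //].
rewrite -(prim_order_dvd theta_prim) => /dvdn_leq; lia.
Qed.

Lemma complex_harmonics :
  harmonics m (psi_rot theta ComplexScalars) (psi_refl R ComplexScalars).
Proof.
have mC : m%:R != 0 :> R[i] by rewrite pnatr_eq0 -lt0n.
(* The negative exponent comes first: a step back by 2 multiplies it by epsilon^j, the first
   diagonal entry of psi_j(r). One exponential suffices for inversion, hence the 0 in [dual]. *)
exists (fun j z => row2 (expi (- x j z)) (expi (x j z)))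
  (fun j z => col2 (expi (x j z) / m%:R) 0) => /=.
- move=> j z; rewrite row2_mx2 half_angleB2 opprB !mulr0 addr0 add0r.
  by rewrite !expiD expiN expi_nat [in LHS]mulrC.
- move=> j z; rewrite row2_mx2 half_angleN opprK.
  by rewrite !(mulr0, mulr1, addr0, add0r).
- move=> j z; rewrite half_angle_period opprD !expiD.
  by rewrite expi_full_turn expi_full_turnN !mulr1.
- move=> j b jm; exists (expi (b%:R * (m%:R * theta / 2))) => q.
  rewrite row2_mx2 scale_row2 half_angle_fold // !(mulr0, mulr1, addr0, add0r).
  rewrite opprB opprD !expiD expi_full_turn expi_full_turnN expi_half_turnN.
  by rewrite !mul1r mulrC.
- move=> i l il; under eq_bigr do rewrite row2_col2 mulr0 addr0 mulrA -expiD.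
  rewrite -raddf_sum -mulr_suml; congr (_%:M).
  under eq_bigr do rewrite addrC.
  by rewrite sum_expi // mulrAC divff // mul1r.
- by move=> j z; rewrite row2_eq0 negb_and expi_neq0.
- move=> j z w j0 jm; have := expi_double_neq1 j0 jm.
  set u := expi theta ^+ j => uu.
  have u0 : u != 0 by rewrite expf_neq0 ?expi_neq0.
  move/(congr1 (fun M : 'M_1 => M 0 0)); rewrite row2_cV mxE => e1.
  move/(congr1 (fun M : 'M_1 => M 0 0)); rewrite row2_cV mxE.
  rewrite half_angleD2 opprD !expiD (expiN (j%:R * _)) expi_nat -/u => e2.
  (* The combination u^2 e1 - u e2 eliminates [w 1 0] and leaves [w 0 0] with a factor u^2 - 1,
     which is nonzero. *)
  have w0 : w 0 0 = 0.
    apply/eqP; move: uu; rewrite -subr_eq0 => /mulfI/mulrI_eq0 <-.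
    rewrite -(mulrI_eq0 _ (mulfI (expi_neq0 (- x j z)))).
    have -> : expi (- x j z) * ((u * u - 1) * w 0 0) =
        u * u * (expi (- x j z) * w 0 0 + expi (x j z) * w 1 0)
        - u * (expi (- x j z) / u * w 0 0 + expi (x j z) * u * w 1 0) by field.
    by rewrite e1 e2 !mulr0 subr0.
  have w1 : w 1 0 = 0.
    move: e1; rewrite w0 mulr0 add0r => /eqP.
    by rewrite mulf_eq0 (negPf (expi_neq0 _)) => /eqP.
  by apply/colP; apply: ord2P; rewrite mxE.
- by rewrite mx2_mul !(mulr0, mulr1, addr0, add0r) mx2_scalar.
- by rewrite expr0 invr1 mx2_scalar.
- by move=> t _ /expi_half ->; rewrite invrN1 mx2_scalar.
- move=> j j0 jm; rewrite mx2_mul; apply/eqP => /matrixP/(_ 0 0).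
  rewrite !mxE /= !(mulr0, addr0) => /eqP.
  by rewrite (negPf (expi_double_neq1 j0 jm)).
Qed.

(** A vanishing sine would make the cosine a sign, and the square of [expi (j%:R * theta)] would be
    1. *)
Lemma sin_neq0 j : (0 < j)%N -> (2 * j < m)%N -> sin (j%:R * theta) != 0.
Proof.
move=> j0 jm; have := expi_double_neq1 j0 jm; apply: contra => /eqP sin0.
rewrite -expi_nat -expiD /expi cosD sinD sin0 !(mulr0, mul0r, addr0, subr0).
by have := cos2Dsin2 (j%:R * theta); rewrite sin0 expr0n addr0 expr2 => ->.
Qed.

Lemma real_harmonics :
  harmonics m (psi_rot theta RealScalars) (psi_refl R RealScalars).
Proof.
have mR : m%:R != 0 :> R by rewrite pnatr_eq0 -lt0n.
have turn k :
    cos (k%:R * (m%:R * theta)) = 1 /\ sin (k%:R * (m%:R * theta)) = 0.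
  by have [] := expi_full_turn k.
(* [har] times [dual] is the cosine of a difference of angles over [m], so inversion is the real
   part of [sum_expi]. *)
exists (fun j z => row2 (cos (x j z)) (sin (x j z)))
  (fun j z => col2 (cos (x j z) / m%:R) (sin (x j z) / m%:R)) => /=.
- move=> j z; rewrite row2_mx2 half_angleB2 cosB sinB; congr row2.
  by rewrite mulrN addrC.
- move=> j z; rewrite row2_mx2 half_angleN cosN sinN.
  by rewrite !(mulrN, mulr0, mulr1, addr0, add0r).
- move=> j z; rewrite half_angle_period cosD sinD; have [-> ->] := turn j.
  by rewrite !(mulr0, mulr1, addr0, subr0).
- move=> j b jm; exists (cos (b%:R * (m%:R * theta / 2))) => q.
  rewrite row2_mx2 scale_row2 half_angle_fold // -addrA.
  rewrite (cosD (q%:R * _)) (sinD (q%:R * _)); have [-> ->] := turn q.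
  (* The exponential of this angle is its own inverse, so the sine equals its own negative. *)
  have sin0 : sin (b%:R * (m%:R * theta / 2)) = 0.
    have [] := expi_half_turnN b; rewrite sinN.
    by move=> _; lra.
  rewrite cosB sinB sin0; congr row2; ring.
- move=> i l il; under eq_bigr do rewrite row2_col2 !mulrA -mulrDl -cosB.
  rewrite -raddf_sum -mulr_suml; congr (_%:M).
  have /(congr1 (@complex.Re R)) := sum_expi (esym il).
  rewrite raddf_sum /= => ->.
  by rewrite -natrM raddfMn /= natrM mulrAC divff // mul1r eq_sym.
- move=> j z; rewrite row2_eq0; apply/negP => /andP[/eqP c0 /eqP s0].
  have := cos2Dsin2 (x j z); rewrite c0 s0 expr0n addr0 => /esym/eqP.
  by rewrite oner_eq0.
- move=> j z w j0 jm; have := sin_neq0 j0 jm => s0.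
  move/(congr1 (fun M : 'M_1 => M 0 0)); rewrite row2_cV mxE => e1.
  move/(congr1 (fun M : 'M_1 => M 0 0)); rewrite row2_cV mxE.
  rewrite half_angleD2 cosD sinD => e2.
  (* By the addition formulas, e2 is cos(j theta) times e1 plus sin(j theta) times this equation. *)
  have e3 : cos (x j z) * w 1 0 - sin (x j z) * w 0 0 = 0.
    apply: (mulfI s0); rewrite mulr0 -[RHS]e2 -[RHS]subr0.
    by rewrite -(mulr0 (cos (j%:R * theta))) -e1; ring.
  have cs := cos2Dsin2 (x j z).
  (* e1 and e3 say that a rotation by the angle [x j z] kills [w]; the inverse rotation recovers
     both entries. *)
  apply/colP; apply: ord2P; rewrite [RHS]mxE.
    rewrite -[LHS]mul1r -cs -[RHS](mulr0 (cos (x j z))) -e1.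
    rewrite -[RHS]subr0 -(mulr0 (sin (x j z))) -e3; ring.
  rewrite -[LHS]mul1r -cs -[RHS](mulr0 (sin (x j z))) -e1.
  rewrite -[RHS]addr0 -(mulr0 (cos (x j z))) -e3; ring.
- by rewrite mx2_mul !(mulr0, mul0r, mulr1, addr0, add0r, mulrNN) mx2_scalar.
- by rewrite mul0r cos0 sin0 oppr0 mx2_scalar.
- move=> t _ /expi_half; rewrite -expi_nat => -[-> ->].
  by rewrite !oppr0 mx2_scalar.
- move=> j j0 jm; rewrite mx2_mul; apply/eqP => /matrixP/(_ 0 0).
  rewrite !mxE /= => e; have /negP[] := sin_neq0 j0 jm.
  (* The top left entry gives cos^2 - sin^2 = 1; with cos^2 + sin^2 = 1 the sine vanishes. *)
  rewrite -sqrf_eq0; apply/eqP; have := cos2Dsin2 (j%:R * theta); lra.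
Qed.

End HalfAngle.

(** * Assembly of the two decompositions *)

Lemma psi_harmonics (R : realType) (k : scalar_kind) (m : nat) (theta : R) :
  (0 < m)%N -> m.-primitive_root (expi theta) ->
  harmonics m (psi_rot theta k) (psi_refl R k).
Proof.
case: k => m_gt0 theta_prim; first exact: real_harmonics.
exact: complex_harmonics.
Qed.

Theorem theorem2p7 (R : realType) (k : scalar_kind) (m : nat) (theta : R)
    (m_gt0 : (0 < m)%N) (theta_prim : m.-primitive_root (expi theta)) :
  let K : fieldType := scalars R k in
  exists V_even V_odd : nat -> {vspace quandle_ring K (2 * m)},
    [/\ forall j : nat, (1 <= j)%N -> (2 * j < m)%N ->
          [/\ is_submodule (V_even j) /\ is_submodule (V_odd j),
              (V_even j <= even_span K (2 * m))%VS,
              (V_odd j <= odd_span K (2 * m))%VS,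
              isomorphic_rep (@quandle_ring_act K m) (V_even j)
                (psi theta k j)
            & isomorphic_rep (@quandle_ring_act K m) (V_odd j)
                (psi theta k j)],
        odd m ->
          [/\ (V_triv_even K m + V_triv_odd K m
               + \sum_(1 <= j < (m.-1 %/ 2).+1) V_even j
               + \sum_(1 <= j < (m.-1 %/ 2).+1) V_odd j)%VS = fullv,
              directv
                (V_triv_even K m + V_triv_odd K m
                 + \sum_(1 <= j < (m.-1 %/ 2).+1) V_even j
                 + \sum_(1 <= j < (m.-1 %/ 2).+1) V_odd j),
              indecomposable (V_triv_even K m),
              indecomposable (V_triv_odd K m)
            & forall j : nat, (1 <= j < (m.-1 %/ 2).+1)%N ->
                indecomposable (V_even j) /\ indecomposable (V_odd j)]
      & forall t : nat, m = (2 * t)%N ->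
          [/\ (V_triv_even K m + V_triv_odd K m
               + V_ref_even K m t + V_ref_odd K m t
               + \sum_(1 <= j < t) V_even j
               + \sum_(1 <= j < t) V_odd j)%VS = fullv,
              directv
                (V_triv_even K m + V_triv_odd K m
                 + V_ref_even K m t + V_ref_odd K m t
                 + \sum_(1 <= j < t) V_even j
                 + \sum_(1 <= j < t) V_odd j),
              indecomposable (V_triv_even K m) /\
                indecomposable (V_triv_odd K m),
              indecomposable (V_ref_even K m t) /\
                indecomposable (V_ref_odd K m t)
            & forall j : nat, (1 <= j < t)%N ->
                indecomposable (V_even j) /\ indecomposable (V_odd j)]].
Proof.
move=> K; have H : harmonics m (psi_rot theta k) (psi_refl R k).
  exact: psi_harmonics.
exists (wave_space H false), (wave_space H true); split.
- move=> j j0 jm; split.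
  + by split; apply: wave_space_submodule.
  + exact: wave_space_even.
  + exact: wave_space_odd.
  + exact: wave_space_rep.
  + exact: wave_space_rep.
- move=> m_odd; rewrite (V_triv_evenE m_gt0 H) (V_triv_oddE m_gt0 H).
  have sum_full := wave_sum_odd m_gt0 H m_odd; split => //.
  (* Two lines and m - 1 planes: 2 + 2(m - 1) = 2m. *)
  + rewrite directvE /= sum_full dimvf dim_matrix !(wave_space0_dim m_gt0).
    by rewrite !(wave_space_sum_dim m_gt0); lia.
  + exact: (sign_space_indecomposable m_gt0 _ _ (mulr1 1) (rotation0 H)).
  + exact: (sign_space_indecomposable m_gt0 _ _ (mulr1 1) (rotation0 H)).
  + by move=> j j_int; split; apply: wave_space_indecomposable => //; lia.
- move=> t mt; have At := rot_half H m_gt0 mt.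
  rewrite (V_triv_evenE m_gt0 H) (V_triv_oddE m_gt0 H).
  rewrite (V_ref_evenE m_gt0 H mt) (V_ref_oddE m_gt0 H mt).
  have sum_full := wave_sum_even m_gt0 H mt; split => //.
  (* Four lines and 2(t - 1) planes: 4 + 4(t - 1) = 2m. *)
  + rewrite directvE /= sum_full dimvf dim_matrix !(wave_space0_dim m_gt0).
    rewrite !(wave_space_half_dim m_gt0 _ _ mt).
    by rewrite !(wave_space_sum_dim m_gt0); lia.
  + split;
      exact: (sign_space_indecomposable m_gt0 _ _ (mulr1 1) (rotation0 H)).
  + by split; apply: (sign_space_indecomposable m_gt0 _ _ (mulN1N1 _) At).
  + by move=> j j_int; split; apply: wave_space_indecomposable => //; lia.
Qed.
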